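(* Let $n\ge 3$ and let $w$ be a word of length $n$ over $\{a,b\}$ with exactly two $a$'s. Then $w$ contains at least $\left\lfloor \frac{n-2}{2}\right\rfloor$ abelian squares, and $w$ contains exactly that many abelian squares if $w$ or its reverse is of the form $b^m a b^{n-m-2} a$ (with $0\le m\le n-2$) where $n-m$ is odd and, if $m\ge \left\lfloor \frac{n-1}{2}\right\rfloor$ holds, then $m$ is also odd. Thus, for every $n\ge 3$, $M(2,n)=\lfloor (n-2)/2\rfloor$.
   Context: Words are over the alphabet $\{a,b\}$. For a word $u$, $|u|$ is its length, $|u|_a$ and $|u|_b$ are the numbers of $a$'s and $b$'s in $u$, and its Parikh vector is $\mathcal{P}(u)=[|u|_a,|u|_b]$. A factor of a word is a contiguous subword. An abelian square is a word $uv$ with $|u|=|v|\ge 1$ and $\mathcal{P}(u)=\mathcal{P}(v)$. The number of abelian squares in a word $w$ is the number of distinct words that are abelian squares and occur as factors of $w$. $M(x,n)$ denotes the least number of abelian squares that can occur in a word $w$ over $\{a,b\}$ with $|w|=n$ and $|w|_a=x$. The reverse of a word is the word written backwards. *)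

(* Defs.v *)
From HB Require Import structures.
From mathcomp Require Import all_boot.

Set Implicit Arguments.
Unset Strict Implicit.
Unset Printing Implicit Defensive.

Variant letter := a | b.

Definition bool_of_letter (c : letter) : bool := if c is a then true else false.
Definition letter_of_bool (x : bool) : letter := if x then a else b.

Lemma bool_of_letterK : cancel bool_of_letter letter_of_bool.
Proof. by case. Qed.

HB.instance Definition _ := Finite.copy letter (can_type bool_of_letterK).

Definition word := seq letter.

Definition parikh (u : word) : nat * nat := (count_mem a u, count_mem b u).

(* Decidable form of "s = u ++ v for suitable u, v"; the index is the length
   of u.  See abelian_squareP. *)
Definition abelian_square (s : word) : bool :=
  [exists i : 'I_(size s).+1,
    let u := take i s in let v := drop i s in
    [&& size u == size v, 1 <= size u & parikh u == parikh v]].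

Lemma abelian_squareP (s : word) :
  reflect (exists u v : word,
             [/\ s = u ++ v, size u = size v, 1 <= size u & parikh u = parikh v])
          (abelian_square s).
Proof.
apply: (iffP existsP) => [[i /and3P[/eqP szE u_gt0 /eqP pE]]|].
  by exists (take i s), (drop i s); rewrite cat_take_drop.
move=> [u [v [-> szE u_gt0 pE]]].
have lt_u : size u < (size (u ++ v)).+1 by rewrite ltnS size_cat leq_addr.
exists (Ordinal lt_u) => /=.
by rewrite take_size_cat // drop_size_cat // szE -szE pE u_gt0 !eqxx.
Qed.

(* All factors of w, with repetitions.  See mem_factors. *)
Definition factors (w : word) : seq word :=
  [seq take l (drop i w) | i <- iota 0 (size w).+1, l <- iota 0 (size w).+1].

Lemma mem_factors (u w : word) : (u \in factors w) = infix u w.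
Proof.
apply/allpairsP/idP => [[[i l] /= [_ _ ->]]|/infixP[p [q ->]]].
  by apply/infixP; exists (take i w), (drop l (drop i w)); rewrite !cat_take_drop.
exists (size p, size u); split; last by rewrite drop_size_cat // take_size_cat.
  by rewrite mem_iota leq0n add0n ltnS !size_cat leq_addr.
by rewrite mem_iota leq0n add0n ltnS !size_cat addnCA leq_addr.
Qed.

Definition num_abelian_squares (w : word) : nat :=
  size (undup [seq u <- factors w | abelian_square u]).

(* The base point a^x b^(n-x) has exactly x letters a when x <= n; for x > n
   no word qualifies and the value is meaningless.  See M_spec. *)
Definition M (x n : nat) : nat :=
  let w0 : n.-tuple letter := [tuple if i < x then a else b | i < n] in
  num_abelian_squares
    [arg min_(w < w0 | count_mem a w == x) num_abelian_squares w].

Lemma M_spec (x n : nat) : x <= n ->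
  (exists w : word,
     [/\ size w = n, count_mem a w = x & num_abelian_squares w = M x n]) /\
  (forall w : word, size w = n -> count_mem a w = x ->
     M x n <= num_abelian_squares w).
Proof.
move=> le_xn; rewrite /M; case: arg_minnP => [|w0 /eqP w0x minw0].
  have H : count (fun k => k < x) (iota 0 n) = x.
    rewrite -[n](subnKC le_xn) iotaD count_cat add0n.
    rewrite (eq_in_count (a2 := predT)); last first.
      by move=> i; rewrite mem_iota => /andP[].
    rewrite count_predT size_iota (eq_in_count (a2 := pred0)).
      by rewrite count_pred0 addn0.
    by move=> i; rewrite mem_iota => /andP[/leq_gtF].
  rewrite -[X in _ == X]H -[in X in _ == X]val_enum_ord /= !count_map.
  by apply/eqP/eq_count => i /=; case: (i < x).
split=> [|w szw wx]; first by exists w0; rewrite size_tuple.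
have w_n : size w == n by apply/eqP.
by apply: (minw0 (Tuple w_n)); apply/eqP.
Qed.

(* Main.v *)
Require Import Defs.
From mathcomp Require Import all_boot.
From mathcomp Require Import zify.

(** A word with two [a]'s is [two_a p q r], i.e. [b^p a b^q a b^r].  The two
    halves of an abelian square contain equally many [a]'s, so such a square
    inside [two_a p q r] has no [a] or two.  Those with no [a] are the words
    [b^(2k)] with [1 <= k] and [2k <= max(p, q, r)].  Those with two [a]'s are
    the words [b^i a b^q a b^j] with [i <= p], [j <= r] that can be cut in
    their middle between the two [a]'s, which amounts to [|i - j| <= q] with
    [i + j + q] even (the predicate [balanced]).  As the exponents determine
    the word, the number of abelian squares is exactly [max(p, q, r) / 2] plus
    the number of such pairs [(i, j)] ([num_abelian_squares_two_a]).

    Reversing a word preserves the count, so let [r <= p].  The pairs with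
    [j = 0] can be counted exactly; together with the squares [b^(2k)] they
    account for [(p + q) / 2] or [(p + q) / 2 + 1] squares.  Every further
    [j <= r] contributes at least one pair, hence at least
    [(p + q) / 2 + r >= (p + q + r) / 2] squares in total.  The words
    singled out by the theorem, or their reverses, have [r = 0], so that the
    pairs with [j = 0] are all there are, and the parity conditions on them say
    that the count is the smaller of its two possible values. *)

(** * Words with few [a]'s *)

Definition two_a (p q r : nat) : word :=
  nseq p b ++ a :: nseq q b ++ a :: nseq r b.

Lemma count_a_nseq_b k : count_mem a (nseq k b) = 0.
Proof. by rewrite count_nseq. Qed.

Lemma no_a_nseq (u : word) : count_mem a u = 0 -> u = nseq (size u) b.
Proof. by elim: u => [|[] u IHu] //= /IHu {1}->. Qed.

Lemma parikh_count_a (u v : word) :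
  parikh u = parikh v -> count_mem a u = count_mem a v.
Proof. by case. Qed.

Lemma first_a_split k (u : word) : count_mem a u = k.+1 ->
  exists p v, u = nseq p b ++ a :: v /\ count_mem a v = k.
Proof.
elim: u => [|[] u IHu] //= Hu; first by exists 0, u; case: Hu.
by case: (IHu Hu) => p [v [-> Hv]]; exists p.+1, v.
Qed.

Lemma one_a_split (u : word) : count_mem a u = 1 ->
  exists p q, u = nseq p b ++ a :: nseq q b.
Proof.
by move=> /first_a_split[p [v [-> /no_a_nseq->]]]; exists p, (size v).
Qed.

Lemma two_a_split (u : word) : count_mem a u = 2 ->
  exists p q r, u = two_a p q r.
Proof.
move=> /first_a_split[p [v [-> /one_a_split[q [r ->]]]]].
by exists p, q, r.
Qed.

Lemma first_a_inj p p' (u u' : word) :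
  nseq p b ++ a :: u = nseq p' b ++ a :: u' -> p = p' /\ u = u'.
Proof.
elim: p p' => [|p IHp] [|p'] //=; first by case.
by case=> /IHp[-> ->].
Qed.

Lemma nseq_b_inj k k' : nseq k b = nseq k' b -> k = k'.
Proof. by move/(congr1 size); rewrite !size_nseq. Qed.

Lemma two_a_inj p q r p' q' r' :
  two_a p q r = two_a p' q' r' -> [/\ p = p', q = q' & r = r'].
Proof. by move=> /first_a_inj[-> /first_a_inj[-> /nseq_b_inj->]]. Qed.

Lemma size_two_a p q r : size (two_a p q r) = p + q + r + 2.
Proof. by rewrite /two_a size_cat /= size_cat /= !size_nseq; lia. Qed.

Lemma count_a_two_a p q r : count_mem a (two_a p q r) = 2.
Proof. by rewrite /two_a count_cat /= count_cat /= !count_a_nseq_b. Qed.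

Lemma rev_nseq_b k : rev (nseq k b) = nseq k b.
Proof.
by rewrite [LHS]no_a_nseq ?size_rev ?size_nseq // count_rev count_a_nseq_b.
Qed.

Lemma rev_two_a p q r : rev (two_a p q r) = two_a r q p.
Proof.
by rewrite /two_a rev_cat rev_cons rev_cat rev_cons !rev_nseq_b
           -!cats1 -!catA.
Qed.

(** * Abelian squares among the factors *)

(** Gluing [b]'s on either side of an [a]-free factor only lengthens one of
    the three runs, so the factor fits in a run; which run depends on how many
    of the two [a]'s lie before the factor. *)
Lemma infix_nseq_two_a l p q r :
  infix (nseq l b) (two_a p q r) = (l <= maxn p (maxn q r)).
Proof.
apply/infixP/idP => [[x [y E]]|le_l].
  have cE : count_mem a x + count_mem a y = 2.
    have := congr1 (count_mem a) E.
    by rewrite count_a_two_a !count_cat count_a_nseq_b add0n.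
  case cx: (count_mem a x) => [|[|[|c]]]; last by lia.
  - have cy : count_mem a y = 2 by lia.
    have [p' [q' [r' Ey]]] := two_a_split _ cy.
    move: E; rewrite (no_a_nseq _ cx) Ey /two_a !catA -!nseqD.
    by move=> /first_a_inj[-> _]; lia.
  - have cy : count_mem a y = 1 by lia.
    have [k [k' Ex]] := one_a_split _ cx; have [s [t Ey]] := one_a_split _ cy.
    move: E; rewrite Ex Ey -catA cat_cons.
    move=> /first_a_inj[_]; rewrite !catA -!nseqD.
    by move=> /first_a_inj[-> _]; lia.
  - have cy : count_mem a y = 0 by lia.
    have [p' [q' [r' Ex]]] := two_a_split _ cx.
    move: E; rewrite Ex (no_a_nseq _ cy) /two_a -catA cat_cons.
    move=> /first_a_inj[_]; rewrite -catA cat_cons.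
    by move=> /first_a_inj[_]; rewrite -!nseqD => /nseq_b_inj->; lia.
have split_run m : l <= m -> nseq m b = nseq l b ++ nseq (m - l) b.
  by move=> le_lm; rewrite -nseqD subnKC.
rewrite /two_a; case: (leqP l p) => [/split_run->|lt_p].
  by exists [::], (nseq (p - l) b ++ a :: nseq q b ++ a :: nseq r b); rewrite !catA.
case: (leqP l q) => [/split_run->|lt_q].
  by exists (nseq p b ++ [:: a]), (nseq (q - l) b ++ a :: nseq r b); rewrite -!catA.
have /split_run-> : l <= r by lia.
by exists (nseq p b ++ a :: nseq q b ++ [:: a]), (nseq (r - l) b);
   rewrite -!catA /= -!catA.
Qed.

Lemma infix_two_a i q' j p q r :
  infix (two_a i q' j) (two_a p q r) = [&& q' == q, i <= p & j <= r].
Proof.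
apply/infixP/and3P => [[x [y E]]|[/eqP-> le_i le_j]].
  have := congr1 (count_mem a) E.
  rewrite count_a_two_a count_cat [count _ (_ ++ y)]count_cat count_a_two_a => cE.
  have cx : count_mem a x = 0 by lia.
  have cy : count_mem a y = 0 by lia.
  move: E; rewrite (no_a_nseq _ cx) (no_a_nseq _ cy) /two_a -catA cat_cons.
  rewrite catA -nseqD => /first_a_inj[->]; rewrite -catA cat_cons.
  move=> /first_a_inj[->]; rewrite -nseqD => /nseq_b_inj->.
  by split=> //; lia.
exists (nseq (p - i) b), (nseq (r - j) b).
rewrite /two_a -catA cat_cons catA -nseqD subnK //.
by rewrite -catA cat_cons -nseqD subnKC.
Qed.

Lemma abelian_square_nseq l :
  abelian_square (nseq l b) = (0 < l) && ~~ odd l.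
Proof.
apply/abelian_squareP/andP => [[u [v [E szE u_gt0 _]]]|[l_gt0 ev_l]].
  by have := congr1 size E; rewrite size_nseq size_cat -szE; lia.
exists (nseq l./2 b), (nseq l./2 b); rewrite -nseqD size_nseq.
by split=> //; [congr nseq|]; lia.
Qed.

(** The middle of [two_a i q j] exists and falls between its two [a]'s. *)
Definition balanced (q i j : nat) : bool :=
  [&& i <= j + q, j <= i + q & ~~ odd (i + j + q)].

(** The two halves are [b^i a b^s] and [b^t a b^j] with [s + t = q] and
    [i + s = t + j]; solving for [s] and [t] gives [balanced]. *)
Lemma abelian_square_two_a i q j :
  abelian_square (two_a i q j) = balanced q i j.
Proof.
apply/abelian_squareP/and3P => [[u [v [E szE _ pE]]]|[le_i le_j ev]].
  have ca := parikh_count_a _ _ pE.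
  have cE : count_mem a u + count_mem a v = 2.
    by rewrite -count_cat -E count_a_two_a.
  have cu : count_mem a u = 1 by lia.
  have cv : count_mem a v = 1 by lia.
  have [i' [s Eu]] := one_a_split _ cu; have [t [j' Ev]] := one_a_split _ cv.
  move: E szE; rewrite Eu Ev /two_a -catA cat_cons => /first_a_inj[->].
  rewrite catA -nseqD => /first_a_inj[-> /nseq_b_inj->].
  by rewrite !size_cat /= !size_nseq => szE; split; lia.
exists (nseq i b ++ a :: nseq ((q + j - i)./2) b),
       (nseq ((q + i - j)./2) b ++ a :: nseq j b).
split.
- rewrite /two_a -catA cat_cons catA -nseqD.
  by have -> : (q + j - i)./2 + (q + i - j)./2 = q by lia.
- by rewrite !size_cat /= !size_nseq; lia.
- by rewrite size_cat /=; lia.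
- by rewrite /parikh !count_cat /= !count_nseq /=; congr (_, _); lia.
Qed.

Lemma abelian_square_even_count_a (s : word) :
  abelian_square s -> ~~ odd (count_mem a s).
Proof.
move=> /abelian_squareP[u [v [-> _ _ pE]]].
by rewrite count_cat (parikh_count_a _ _ pE) addnn odd_double.
Qed.

(** * The exact number of abelian squares *)

(** The number of abelian squares [two_a i q j] with [i <= p]. *)
Definition balanced_count (p q j : nat) : nat :=
  count (balanced q ^~ j) (iota 0 p.+1).

Lemma num_abelian_squares_two_a p q r :
  num_abelian_squares (two_a p q r) =
  (maxn p (maxn q r))./2 + \sum_(0 <= j < r.+1) balanced_count p q j.
Proof.
set m := maxn _ _.
pose Lb := [seq nseq k.*2 b | k <- iota 1 m./2].
pose La := [seq two_a i q j | j <- iota 0 r.+1,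
                              i <- [seq i <- iota 0 p.+1 | balanced q i j]].
have szL : size (Lb ++ La) =
    m./2 + \sum_(0 <= j < r.+1) balanced_count p q j.
  rewrite size_cat size_map size_iota size_allpairs_dep sumnE big_map.
  congr (_ + _); rewrite /index_iota subn0.
  by apply: eq_bigr => j _; rewrite size_filter.
rewrite -szL /num_abelian_squares; apply/perm_size/uniq_perm.
- exact: undup_uniq.
- rewrite cat_uniq; apply/and3P; split.
  + rewrite map_inj_in_uniq ?iota_uniq // => k k' _ _ /nseq_b_inj; lia.
  + apply/hasPn => u /allpairsPdep[j [i [_ _ ->]]]; apply/negP => /mapP[k _].
    by move/(congr1 (count_mem a)); rewrite count_a_two_a count_a_nseq_b.
  + apply: allpairs_uniq_dep; first exact: iota_uniq.
      by move=> j _; rewrite filter_uniq ?iota_uniq.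
    by move=> [j i] [j' i'] _ _ /= /two_a_inj[-> _ ->].
move=> u; rewrite mem_undup mem_filter mem_factors mem_cat.
apply/andP/orP => [[sq_u inf_u]|].
  have le_cu : count_mem a u <= 2.
    rewrite -(count_a_two_a p q r).
    by have /infixP[x [y ->]] := inf_u; rewrite !count_cat addnCA leq_addr.
  have := abelian_square_even_count_a _ sq_u.
  case cu: (count_mem a u) le_cu => [|[|[|c]]] // _ _; [left|right].
    move: sq_u inf_u; rewrite (no_a_nseq _ cu); move: (size u) => l.
    rewrite abelian_square_nseq infix_nseq_two_a -/m => /andP[l_gt0 ev_l] le_l.
    apply/mapP; exists l./2; last by rewrite even_halfK.
    by rewrite mem_iota; lia.
  have [i [q' [j Eu]]] := two_a_split _ cu.
  move: sq_u inf_u; rewrite Eu abelian_square_two_a infix_two_a.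
  move=> bal /and3P[/eqP Eq le_i le_j]; rewrite Eq in bal *.
  by apply/allpairsPdep; exists j, i; split; rewrite // ?mem_filter ?mem_iota ?bal.
case=> [/mapP[k]|/allpairsPdep[j [i []]]].
  rewrite mem_iota => k_in ->.
  by rewrite abelian_square_nseq infix_nseq_two_a -/m; split; lia.
rewrite mem_filter !mem_iota => j_in /andP[bal i_in] ->.
by rewrite abelian_square_two_a infix_two_a bal eqxx; split; lia.
Qed.

(** The squares [b^i a b^q a] that end with the second [a] are those with
    [i <= q] of the parity of [q]. *)
Lemma balanced_count0 p q :
  balanced_count p q 0 = (minn p q + 1 + ~~ odd q)./2.
Proof.
have cnt m : count (balanced q ^~ 0) (iota 0 m) =
             (minn m q.+1 + ~~ odd q)./2.
  elim: m => [|m IHm]; first by rewrite min0n; case: (odd q).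
  rewrite -addn1 iotaD count_cat IHm /= /balanced add0n.
  by case: (leqP m q); lia.
by rewrite /balanced_count cnt; congr (_./2); lia.
Qed.

Lemma balanced_count_gt0 p q j : j <= p -> 0 < j -> 0 < balanced_count p q j.
Proof.
move=> le_jp j_gt0; rewrite -has_count; apply/hasP.
(* Near the diagonal only the parity of i + j + q is a constraint. *)
exists (j - odd q); first by rewrite mem_iota; lia.
by rewrite /balanced; case odd_q: (odd q); lia.
Qed.

Lemma num_abelian_squares_two_a0 p q :
  num_abelian_squares (two_a p q 0) =
  (maxn p q)./2 + (minn p q + 1 + ~~ odd q)./2.
Proof.
by rewrite num_abelian_squares_two_a big_nat1 balanced_count0 maxn0.
Qed.

Lemma num_abelian_squares_two_a_ge p q r : r <= p ->
  (p + q + r) %/ 2 <= num_abelian_squares (two_a p q r).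
Proof.
move=> le_rp; rewrite num_abelian_squares_two_a big_ltn // balanced_count0.
have: r <= \sum_(1 <= j < r.+1) balanced_count p q j.
  have {1}-> : r = \sum_(1 <= j < r.+1) 1 by rewrite sum_nat_const_nat; lia.
  rewrite big_nat [X in _ <= X]big_nat; apply: leq_sum => j /andP[j_gt0 le_j].
  by apply: balanced_count_gt0 => //; lia.
lia.
Qed.

(** * Reversal *)

Lemma abelian_square_rev (s : word) :
  abelian_square (rev s) = abelian_square s.
Proof.
have imp (t : word) : abelian_square t -> abelian_square (rev t).
  move=> /abelian_squareP[u [v [-> szE u_gt0 pE]]]; apply/abelian_squareP.
  exists (rev v), (rev u); rewrite rev_cat !size_rev -szE; split=> //.
  by rewrite /parikh !count_rev; apply/esym.
by apply/idP/idP => /imp; rewrite ?revK.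
Qed.

Lemma num_abelian_squares_rev (w : word) :
  num_abelian_squares (rev w) = num_abelian_squares w.
Proof.
rewrite /num_abelian_squares -[RHS](size_map rev); apply/perm_size/uniq_perm.
- exact: undup_uniq.
- by rewrite map_inj_uniq ?undup_uniq //; apply: inv_inj; apply: revK.
move=> u; rewrite -[u in RHS]revK mem_map; last by apply: inv_inj; apply: revK.
by rewrite !mem_undup !mem_filter !mem_factors abelian_square_rev
           -(infix_rev u) revK.
Qed.

(** * Words with exactly two [a]'s *)

Lemma num_abelian_squares_ge (w : word) : count_mem a w = 2 ->
  (size w - 2) %/ 2 <= num_abelian_squares w.
Proof.
move=> /two_a_split[p [q [r ->]]]; rewrite size_two_a addnK.
case: (leqP r p) => [|/ltnW le_pr]; first exact: num_abelian_squares_two_a_ge.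
rewrite -num_abelian_squares_rev rev_two_a (_ : p + q + r = r + q + p); last lia.
exact: num_abelian_squares_two_a_ge.
Qed.

(** For odd [q] the count is [max(p, q) / 2 + (min(p, q) + 1) / 2], both
    quotients rounded down.  If the odd number [q] is the maximum, the two
    roundings combine to [(p + q) / 2]; if [p] is the maximum, they do so only
    for odd [p]. *)
Lemma num_abelian_squares_extremal n m : 3 <= n -> m <= n - 2 ->
  odd (n - m) -> ((n - 1) %/ 2 <= m -> odd m) ->
  num_abelian_squares (two_a m (n - m - 2) 0) = (n - 2) %/ 2.
Proof. by move=> *; rewrite num_abelian_squares_two_a0; lia. Qed.

Theorem theorem7 (n : nat) (hn : 3 <= n) :
  (forall w : word, size w = n -> count_mem a w = 2 ->
     (n - 2) %/ 2 <= num_abelian_squares w /\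
     ((exists m : nat,
         [/\ m <= n - 2,
             w = nseq m b ++ [:: a] ++ nseq (n - m - 2) b ++ [:: a] \/
             rev w = nseq m b ++ [:: a] ++ nseq (n - m - 2) b ++ [:: a],
             odd (n - m) &
             (n - 1) %/ 2 <= m -> odd m]) ->
      num_abelian_squares w = (n - 2) %/ 2)) /\
  M 2 n = (n - 2) %/ 2.
Proof.
split=> [w szw cw|].
  split; first by rewrite -szw num_abelian_squares_ge.
  move=> [m [le_m Ew odd_nm Hm]].
  rewrite -(num_abelian_squares_extremal n m) //.
  by case: Ew => [->|Ew] //; rewrite -num_abelian_squares_rev Ew.
have [[w [szw cw Mw]] minM] := M_spec (ltnW hn).
apply/eqP; rewrite eqn_leq -{2}Mw -[in X in _ && X]szw num_abelian_squares_ge //.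
(* Extremal words: b a b^(n-3) a for even n, and a b^(n-2) a for odd n. *)
rewrite andbT -(num_abelian_squares_extremal n (~~ odd n)) //; try lia.
by apply: minM; rewrite ?count_a_two_a // size_two_a; lia.
Qed.
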